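(* Let $a,b\in\mathbb F_q^*$, $c=ab^{-1}$, $\ell=\mathrm{ord}(c)$, and let $\mathbf A=(A(a),A(b))$. Let $n$ be a positive integer such that $[n]\in S(a,b)$, and let $d_0\le n$ be the least nonnegative integer such that $b^{-n}=c^{d_0}$. Put $s(n)=\left\lfloor\frac{n-d_0}{\ell}\right\rfloor$. Then the set $F_n(\mathbf A)$ comprises exactly the polynomials of the form $$y^{n-d_0}x^{d_0}\,h\!\left(\frac{x^{\ell}}{y^{\ell}}\right),$$ where $h=0$ or $h$ is a univariate polynomial over $\mathbb F_q$ of degree at most $s(n)$. In particular, the size of $F_n(\mathbf A)$ equals $$1+(q-1)\sum_{0\le s\le s(n)}q^{s}=q^{s(n)+1}.$$
   Context: $\mathbb F_q$ is the finite field with $q$ elements, $q$ a prime power; $\mathrm{ord}$ denotes multiplicative order in $\mathbb F_q^*$. For $a\in\mathbb F_q^*$, $A(a)=\begin{pmatrix}a&0\\0&1\end{pmatrix}$. The pair $\mathbf A=(A(a),A(b))$ acts on $\mathbb F_q[x,y]$ by $\mathbf A\circ g:=g(ax,by)$. $F_n$ is the set of polynomials in $\mathbb F_q[x,y]$ that are zero or homogeneous of degree $n$, and $F_n(\mathbf A):=\{g\in F_n:\mathbf A\circ g=g\}$. With $k=\mathrm{ord}(b)$, $S(a,b)$ is the set of nonnegative integers $m\le k$ such that there exists a nonnegative integer $d\le m$ with $b^{-m}=c^{d}$; $[n]$ denotes the least nonnegative integer $r$ with $n\equiv r\pmod k$. *)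

(* Defs.v *)
From HB Require Import structures.
From mathcomp Require Import all_boot all_order all_algebra all_fingroup.
From mathcomp Require Import finmap.
From mathcomp Require Import mpoly.

Set Implicit Arguments.
Unset Strict Implicit.
Unset Printing Implicit Defensive.

Import GRing.Theory.
Local Open Scope ring_scope.

Section Defs.

Variable F : finFieldType.

Definition matA (a : {unit F}) : 'M[F]_2 :=
  diag_mx (\row_(j < 2) if j == 0 then val a else 1).

(* In F[x, y], x is 'X_0 and y is 'X_1. *)
Definition varx : {mpoly F[2]} := 'X_(0 : 'I_2).
Definition vary : {mpoly F[2]} := 'X_(1 : 'I_2).

(* A matrix with bottom row (0, 1) stands for the affine substitution
   t |-> A 0 0 * t + A 0 1, so that the pair (matA a, matA b) sends g(x, y)
   to g(a x, b y). *)
Definition pair_act (A : 'M[F]_2 * 'M[F]_2) (g : {mpoly F[2]}) : {mpoly F[2]} :=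
  g \mPo [tuple A.1 0 0 *: varx + (A.1 0 1)%:MP;
                A.2 0 0 *: vary + (A.2 0 1)%:MP].

(* 0 is n.-homog for every n. *)
Definition invariant_forms (n : nat) (A : 'M[F]_2 * 'M[F]_2) :
  {pred {mpoly F[2]}} :=
  [pred g | (g \is n.-homog) && (pair_act A g == g)].

Definition setS (a b : {unit F}) : {pred nat} :=
  [pred m : nat | (m <= #[b]%g)%N &&
     [exists d : 'I_m.+1, (b ^- m == (a * b^-1) ^+ d)%g]].

Definition is_d0 (a b : {unit F}) (n d0 : nat) : Prop :=
  [/\ (d0 <= n)%N, (b ^- n = (a * b^-1) ^+ d0)%g
    & forall d : nat, (b ^- n = (a * b^-1) ^+ d)%g -> (d0 <= d)%N].

Definition fracX : {fraction {mpoly F[2]}} := tofrac varx.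
Definition fracY : {fraction {mpoly F[2]}} := tofrac vary.
Definition fracC (u : F) : {fraction {mpoly F[2]}} := tofrac u%:MP.

(* y^(n - d0) x^d0 h(x^l / y^l), computed in the fraction field F(x, y). *)
Definition special_form (n d0 l : nat) (h : {poly F}) :
  {fraction {mpoly F[2]}} :=
  fracY ^+ (n - d0) * fracX ^+ d0
    * (map_poly fracC h).[fracX ^+ l / fracY ^+ l].

End Defs.

(* Main.v *)
(* A monomial x^i y^j with i + j = n is scaled by a^i b^j = b^n c^i, so a form
   of degree n is invariant iff it is supported on the monomials with c^i = b^-n.
   By minimality of d0, the solutions i <= n of that equation are exactly the
   d0 + l t with t <= s(n), so F_n(A) is a vector space of dimension s(n) + 1. *)
Require Import Defs.
From HB Require Import structures.
From mathcomp Require Import all_boot all_order all_algebra all_fingroup.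
From mathcomp Require Import cyclic.
From mathcomp Require Import finmap.
From mathcomp Require Import mpoly.

Set Implicit Arguments.
Unset Strict Implicit.
Unset Printing Implicit Defensive.

Import GRing.Theory.
Local Open Scope ring_scope.

Definition bimon (i j : nat) : 'X_{1..2} := (U_(0%R) *+ i + U_(1%R) *+ j)%MM.

Lemma bimon0 i j : bimon i j (0 : 'I_2) = i.
Proof. by rewrite mnmDE !mulmnE !mnm1E /= mul1n mul0n addn0. Qed.

Lemma bimon1 i j : bimon i j (1 : 'I_2) = j.
Proof. by rewrite mnmDE !mulmnE !mnm1E /= mul1n mul0n. Qed.

Lemma bimonE (m : 'X_{1..2}) : m = bimon (m 0) (m 1).
Proof.
apply/mnmP => i; have: (i == 0) || (i == 1) by case: i => -[|[|]].
by case/orP => /eqP ->; rewrite ?bimon0 ?bimon1.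
Qed.

Lemma mdeg_bimon i j : mdeg (bimon i j) = (i + j)%N.
Proof. by rewrite mdegD !mdegMn !mdeg1 !mul1n. Qed.

Lemma mpolyX_bimon (F : finFieldType) i j :
  'X_[bimon i j] = varx F ^+ i * vary F ^+ j.
Proof. by rewrite mpolyXD !mpolyXn. Qed.

(* The %R is needed: 'I_2 is also an additive group, in which 1%g is 0. *)
Lemma mcoeff_pair_act (F : finFieldType) (a b : {unit F}) (g : {mpoly F[2]})
    (m : 'X_{1..2}) :
  (pair_act (matA a, matA b) g)@_m = val (a ^+ m 0%R * b ^+ m 1%R)%g * g@_m.
Proof.
elim/mpolyind: g => [|u k g _ _ IH].
  by rewrite /pair_act comp_mpoly0 !mcoeff0 mulr0.
(* The substitution is linear and multiplies [x^i y^j] by [a^i b^j]. *)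
have -> : pair_act (matA a, matA b) (u *: 'X_[k] + g)
    = u *: (val (a ^+ k 0%R * b ^+ k 1%R)%g *: 'X_[k])
      + pair_act (matA a, matA b) g.
  rewrite FinRing.val_unitM !FinRing.val_unitX.
  rewrite /pair_act comp_mpolyD comp_mpolyZ; congr (_ *: _ + _).
  rewrite comp_mpolyX !big_ord_recl big_ord0 mulr1 !(tnth_nth 0) /=.
  have -> : lift ord0 ord0 = 1 :> 'I_2 by apply: val_inj.
  rewrite !mxE /= !mulr1n !mulr0n mpolyC0 !addr0 !exprZn.
  rewrite -scalerAl -scalerAr scalerA.
  by rewrite -mpolyX_bimon -[ord0]/(0 : 'I_2) -bimonE.
rewrite !mcoeffD IH !mcoeffZ mcoeffX mulrDr; congr (_ + _).
by case: eqP => [->|_]; rewrite ?mulr1 ?mulr0 // mulrC.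
Qed.

(** Since [a] and [b] commute, [(a b^-1)^i b^(i+j) = a^i b^j]; cancelling [b^(i+j)] on the right
    turns one equation into the other. *)
Lemma expg_unit_balance (F : finFieldType) (a b : {unit F}) (i j : nat) :
  (a ^+ i * b ^+ j == 1)%g = (b ^- (i + j) == (a * b^-1) ^+ i)%g.
Proof.
rewrite expgMn; last by apply: val_inj; rewrite !FinRing.val_unitM mulrC.
rewrite [RHS]eq_sym -[RHS](inj_eq (mulIg (b ^+ (i + j))%g)) mulVg expgVn.
by rewrite -mulgA expgD mulKg.
Qed.

(** Invariance reads [a^i b^j g_ij = g_ij] on coefficients, and a nonzero [g_ij] can be
    cancelled. *)
Lemma mem_invariant_forms (F : finFieldType) (a b : {unit F}) (n : nat)
    (g : {mpoly F[2]}) :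
  reflect (forall i j, g@_(bimon i j) != 0 ->
             (i + j)%N = n /\ (b ^- n = (a * b^-1) ^+ i)%g)
          (g \in invariant_forms n (matA a, matA b)).
Proof.
apply: (iffP andP) => [[/dhomogP gn /eqP gA] i j gij | supp_g].
  have En : (i + j)%N = n.
    by rewrite -mdeg_bimon; apply: gn; rewrite mcoeff_msupp.
  split=> //; apply/eqP; rewrite -En -expg_unit_balance; apply/eqP/val_inj.
  apply: (mulIf gij); rewrite mul1r -[RHS](congr1 (mcoeff _) gA).
  by rewrite mcoeff_pair_act bimon0 bimon1.
split.
  apply/dhomogP => m; rewrite mcoeff_msupp (bimonE m) => /supp_g[<- _].
  exact: mdeg_bimon.
apply/eqP/mpolyP => m; rewrite mcoeff_pair_act.
have [->|] := eqVneq g@_m 0; first by rewrite mulr0.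
rewrite {1}(bimonE m) => /supp_g[En /eqP]; rewrite -En -expg_unit_balance.
by move=> /eqP ->; rewrite mul1r.
Qed.

Lemma is_d0_ex (F : finFieldType) (a b : {unit F}) (n : nat) :
  (n %% #[b]%g)%N \in setS a b -> exists d0, is_d0 a b n d0.
Proof.
case/andP => _ /existsP[d /eqP Ed].
have ex : exists d, (b ^- n == (a * b^-1) ^+ d)%g.
  by exists d; rewrite -Ed expg_mod_order.
case: (ex_minnP ex) => d0 /eqP E0 min0; exists d0; split=> //.
  (* The witness [d] from [setS] satisfies [d <= [n] <= n], and minimality gives [d0 <= d]. *)
  apply: leq_trans (leq_mod n #[b]%g).
  apply: (@leq_trans d); last by case: d Ed.
  by apply: min0; rewrite -Ed expg_mod_order.
by move=> e /eqP; apply: min0.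
Qed.

(** Two exponents give the same power of [c = a b^-1] iff they agree modulo its order; minimality
    makes [i - d0] a genuine difference. *)
Lemma is_d0_solutions (F : finFieldType) (a b : {unit F}) (n d0 i : nat) :
  is_d0 a b n d0 -> (b ^- n = (a * b^-1) ^+ i)%g ->
  exists t, i = (d0 + #[a * b^-1]%g * t)%N.
Proof.
case=> _ E0 min0 Ei; have le0i := min0 _ Ei.
have: (#[a * b^-1]%g %| i - d0)%N.
  by rewrite -eqn_mod_dvd // -eq_expg_mod_order -Ei E0.
by case/dvdnP => t Et; exists t; rewrite mulnC -Et subnKC.
Qed.

Section FormOf.

Variables (F : finFieldType) (n d0 l : nat).
Hypotheses (l_gt0 : (0 < l)%N) (d0_le : (d0 <= n)%N).

Let s := ((n - d0) %/ l)%N.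

(** This is [y^(n-d0) x^d0 h(x^l/y^l)] with denominators cleared; coefficients of [h] beyond index
    [s] are ignored. *)
Definition form_of (h : {poly F}) : {mpoly F[2]} :=
  \sum_(i < s.+1) h`_i *: 'X_[bimon (d0 + l * i) (n - (d0 + l * i))].

Lemma form_exp_le t : (d0 + l * t <= n)%N = (t < s.+1)%N.
Proof. by rewrite ltnS leq_divRL // leq_subRL // mulnC. Qed.

Lemma mcoeff_form_of h t : (t < s.+1)%N ->
  (form_of h)@_(bimon (d0 + l * t) (n - (d0 + l * t))) = h`_t.
Proof.
move=> lt_ts; rewrite /form_of raddf_sum (bigD1 (Ordinal lt_ts)) //=.
rewrite mcoeffZ mcoeffX eqxx mulr1 big1 ?addr0 // => i ne_it.
rewrite mcoeffZ mcoeffX; case: eqP; rewrite ?mulr0 //.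
(* As [l > 0], the exponent of [x] alone determines the index, so no other term contributes. *)
move/(congr1 (fun m : 'X_{1..2} => m 0)); rewrite !bimon0 => /addnI/eqP.
by rewrite eqn_pmul2l // => /eqP Eit; case/eqP: ne_it; apply: val_inj.
Qed.

Lemma supp_form_of h i j : (form_of h)@_(bimon i j) != 0 ->
  exists2 t, (t < s.+1)%N & i = (d0 + l * t)%N /\ j = (n - (d0 + l * t))%N.
Proof.
move=> nz; suff /existsP[t /eqP/mnmP Et] : [exists t : 'I_s.+1,
    bimon (d0 + l * t) (n - (d0 + l * t)) == bimon i j].
  by exists t => //; move: (Et 0) (Et 1); rewrite !bimon0 !bimon1.
apply: contraR nz => /existsPn nE; rewrite raddf_sum big1 //= => t _.
by rewrite mcoeffZ mcoeffX (negbTE (nE t)) mulr0.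
Qed.

(** The size bound ensures that [form_of] drops no term of [h], and [l i <= n - d0] for [i <= s]
    lets [y^(n-d0)] absorb each denominator [y^(l i)]. *)
Lemma special_form_tofrac (h : {poly F}) : (size h <= s.+1)%N ->
  special_form n d0 l h = tofrac (form_of h).
Proof.
move=> sz; rewrite /special_form /form_of rmorph_sum.
have szm : (size (map_poly (@fracC F) h) <= s.+1)%N.
  by apply: leq_trans sz; apply: size_poly.
rewrite (horner_coef_wide _ szm) big_distrr /=; apply: eq_bigr => i _.
have le_in : (d0 + l * i <= n)%N by rewrite form_exp_le.
have y0 : fracY F != 0 by rewrite /fracY tofrac_eq0 -msize_poly_eq0 msizeX.
rewrite coef_map_id0; last by rewrite /fracC mpolyC0 tofrac0.
rewrite -mul_mpolyC mpolyX_bimon !rmorphM !rmorphXn /=.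
rewrite -/(fracX F) -/(fracY F) -/(fracC _) expr_div_n -!exprM exprD.
have -> : fracY F ^+ (n - d0)
    = fracY F ^+ (n - (d0 + l * i)) * fracY F ^+ (l * i).
  by rewrite -exprD subnDA subnK // leq_subRL.
set Y := fracY F ^+ (l * i); have Y0 : Y != 0 by rewrite expf_neq0.
set P := fracY F ^+ _; set X1 := fracX F ^+ d0; set X2 := fracX F ^+ _.
rewrite mulrCA; congr (_ * _); rewrite -(mulrA P) (mulrC Y) mulrA (mulrC X1 X2).
by rewrite -!mulrA (mulrCA Y) mulfV // mulr1 (mulrC P) -!mulrA mulrCA.
Qed.

End FormOf.

Lemma invariant_forms_form_of (F : finFieldType) (a b : {unit F}) (n d0 : nat)
    (g : {mpoly F[2]}) :
  let l := #[a * b^-1]%g in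
  is_d0 a b n d0 ->
  g \in invariant_forms n (matA a, matA b) <->
  exists2 h : {poly F}, (size h <= ((n - d0) %/ l).+1)%N
                      & g = form_of n d0 l h.
Proof.
move=> l d0P; have [d0_le E0 _] := d0P; have l_gt0 : (0 < l)%N := order_gt0 _.
split=> [/mem_invariant_forms supp_g | [h _ ->]]; last first.
  apply/mem_invariant_forms => i j /supp_form_of[t lt_ts [-> ->]].
  split; first by rewrite subnKC // form_exp_le.
  by rewrite expgD expgM expg_order expg1n mulg1.
(* The polynomial [h] is read off from the coefficients of [g] along the progression [d0 + l t]. *)
exists (\poly_(t < ((n - d0) %/ l).+1)
          g@_(bimon (d0 + l * t) (n - (d0 + l * t)))).
  exact: size_poly.
set h := (X in form_of _ _ _ X); apply/mpolyP => m; rewrite (bimonE m).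
(* A monomial in the support of either side lies on the progression, where the coefficients agree by
   the choice of [h]. *)
move: (m 0) (m 1) => i j; have [gij|] := eqVneq g@_(bimon i j) 0.
  have [-> //|hij] := eqVneq (form_of n d0 l h)@_(bimon i j) 0.
  have [t lt_ts [Ei Ej]] := supp_form_of hij; move: gij; rewrite Ei Ej.
  by rewrite mcoeff_form_of // coef_poly lt_ts.
case/supp_g => En Ei; have [t Et] := is_d0_solutions d0P Ei.
have lt_ts : (t < ((n - d0) %/ l).+1)%N.
  by rewrite -form_exp_le // -Et -En leq_addr.
have -> : j = (n - (d0 + l * t))%N by rewrite -Et -En addKn.
by rewrite Et mcoeff_form_of // coef_poly lt_ts.
Qed.

Theorem theorem6p2 (F : finFieldType) (a b : {unit F}) (n : nat)
    (n_gt0 : (0 < n)%N) (nS : (n %% #[b]%g)%N \in setS a b) :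
  let c := (a * b^-1)%g in
  let l := #[c]%g in
  let A := (matA a, matA b) in
  let q := #|F| in
  (exists d0 : nat, is_d0 a b n d0) /\
  (forall d0 : nat, is_d0 a b n d0 ->
    let s := ((n - d0) %/ l)%N in
    (forall f : {fraction {mpoly F[2]}},
       (exists2 g : {mpoly F[2]}, g \in invariant_forms n A & f = tofrac g) <->
       (exists2 h : {poly F}, h = 0 \/ ((size h).-1 <= s)%N
                            & f = special_form n d0 l h)) /\
    (exists2 X : {fset {mpoly F[2]}},
       X =i invariant_forms n A
     & #|` X |%fset = (1 + (q - 1) * \sum_(0 <= i < s.+1) q ^ i)%N
       /\ #|` X |%fset = (q ^ s.+1)%N)).
Proof.
move=> c l A q; split=> [|d0 d0P s]; first exact: is_d0_ex.
have [d0_le _ _] := d0P; have l_gt0 : (0 < l)%N := order_gt0 c.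
have formsP g := @invariant_forms_form_of F a b n d0 g d0P.
(* The degree is [(size h).-1], and the zero polynomial has size 0, so both alternatives amount to
   one size bound. *)
have size_le (h : {poly F}) :
    (h = 0 \/ ((size h).-1 <= s)%N) <-> (size h <= s.+1)%N.
  rewrite -subn1 leq_subLR add1n; split=> [[->|//]|]; last by right.
  by rewrite size_poly0.
split=> [f|].
  split=> [[g /formsP[h sz_h ->] ->]|[h /size_le sz_h ->]].
    by exists h; [apply/size_le | rewrite special_form_tofrac].
  exists (form_of n d0 l h); last by rewrite special_form_tofrac.
  by apply/formsP; exists h.
(* For the count, forms are parametrized by the [s + 1] coefficients of [h], which can be recovered
   from the form. *)
pose phi (u : 'rV[F]_s.+1) := form_of n d0 l (rVpoly u).
have phi_inj : injective phi.
  move=> u v Euv; apply: (can_inj (@rVpolyK _ _)); apply/polyP => t.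
  have [lt_ts|ge_ts] := ltnP t s.+1; last first.
    by rewrite !nth_default // (leq_trans _ ge_ts) // size_poly.
  by rewrite -!(mcoeff_form_of l_gt0 (d0:=d0) (n:=n)) // -/(phi u) Euv.
exists [fset phi u | u in 'rV[F]_s.+1]%fset => [g|].
  apply/imfsetP/idP => [[u _ ->]|/formsP[h sz_h ->]].
    by apply/formsP; exists (rVpoly u); rewrite // size_poly.
  by exists (poly_rV h); rewrite // /phi poly_rV_K.
have -> : #|` [fset phi u | u in 'rV[F]_s.+1] |%fset = (q ^ s.+1)%N.
  by rewrite card_imfset //= -cardE card_mx mul1n.
split=> //; have q_gt0 : (0 < q)%N by apply/card_gt0P; exists 0.
(* The geometric sum gives [q^(s+1) - 1]; positivity of [q] makes this truncated subtraction
   exact. *)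
by rewrite big_mkord subn1 -predn_exp add1n prednK // expn_gt0 q_gt0.
Qed.
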